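(* The Kähler manifolds $(\mathcal{C}(\mathfrak{H}),\mathbb{J},g_r,\Omega_r)$ and $(\mathfrak{H}\times\mathbb{R}_{>0},\mathbb{I},g',\Omega')$ are PCR-Kähler equivalent, with respect to the subbundle $\mathcal{H}=\langle X,Y\rangle$ on both manifolds.
   Context: The Heisenberg group $\mathfrak{H}$ is $\mathbb{C}\times\mathbb{R}$ with coordinates $(z=x+iy,t)$ and multiplication $(z,t)*(w,s)=(z+w,t+s+2\Im(z\overline w))$. Put $X=\partial_x+2y\,\partial_t$, $Y=\partial_y-2x\,\partial_t$, $T=\partial_t$, $\omega=dt+2x\,dy-2y\,dx$, $\widetilde T=2T$, $\widetilde\omega=\tfrac12\omega$, and $g=dx^2+dy^2+\tfrac14\omega^2$. On $\mathfrak{H}\times\mathbb{R}_{>0}$ with coordinates $(z,t,r)$, the same symbols denote the natural lifts. First structure (the Riemannian cone): $\mathcal{C}(\mathfrak{H})=\mathfrak{H}\times\mathbb{R}_{>0}$ with metric $g_r=dr^2+r^2g$, complex structure $\mathbb{J}X=Y$, $\mathbb{J}Y=-X$, $\mathbb{J}(r\partial_r)=\widetilde T$, $\mathbb{J}\widetilde T=-r\partial_r$, and fundamental form $\Omega_r=d\left(\tfrac{r^2}{2}\widetilde\omega\right)$. Second structure: on $\mathfrak{H}\times\mathbb{R}_{>0}$, complex structure $\mathbb{I}X=Y$, $\mathbb{I}Y=-X$, $\mathbb{I}T=\partial_r$, $\mathbb{I}\partial_r=-T$, metric $g'=\frac{4}{r}(dx^2+dy^2)+\frac{1}{r^2}(\omega^2+dr^2)$,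 and fundamental form $\Omega'=\frac{4}{r}dx\wedge dy+\frac{1}{r^2}\omega\wedge dr$. In both cases $\mathcal{H}$ is the bundle spanned at each point by $X,Y$, regarded as the subbundle of the $(1,0)$-tangent bundle spanned by $Z=\tfrac12(X-iY)$. PCR-Kähler equivalence: let $N$, $N'$ be Kähler manifolds of the same dimension with metrics $g_N,g_{N'}$, and let $\mathcal{H}_N\subset T^{(1,0)}(N)$, $\mathcal{H}_{N'}\subset T^{(1,0)}(N')$ be subbundles. The manifolds are PCR-Kähler equivalent (with respect to these subbundles) if there is a diffeomorphism $G:N\to N'$ such that (i) $G_*(\mathcal{H}_N)=\mathcal{H}_{N'}$, and (ii) $G^*\left(g_{N'}|_{\mathcal{H}_{N'}\times\mathcal{H}_{N'}}\right)=g_N|_{\mathcal{H}_N\times\mathcal{H}_N}$, that is, $g_{N'}(G_*U,G_*V)=g_N(U,V)$ for all $U,V$ in the underlying real subbundle of $\mathcal{H}_N$. *)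

(* Defs.v *)
From HB Require Import structures.
From mathcomp Require Import all_boot all_order all_algebra.
From mathcomp Require Import all_classical all_reals all_analysis.
From mathcomp Require Import complex ring.

Set Implicit Arguments.
Unset Strict Implicit.
Unset Printing Implicit Defensive.

Import Order.TTheory GRing.Theory Num.Theory.
Import numFieldNormedType.Exports.

Local Open Scope classical_set_scope.
Local Open Scope ring_scope.

(** * Calculus on open subsets of R^n

    Every manifold below is an open set [U] of ['rV[R]_n] with its global
    coordinates, so that every tangent space is ['rV[R]_n].  A vector field,
    a 1-form, a 2-form or a metric is a function of the base point and then of
    tangent vectors; only its values over [U] matter. *)

Section Calculus.
Context {R : realType} {n : nat}.
Local Notation pt := 'rV[R]_n.

Definition iterated_partial {W : normedModType R} (s : seq 'I_n) (f : pt -> W)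
  : pt -> W :=
  foldr (fun i g => fun x => 'D_(delta_mx 0 i) g x) f s.

Definition smooth_on {W : normedModType R} (U : set pt) (f : pt -> W) : Prop :=
  forall (s : seq 'I_n) (p : pt), U p -> differentiable (iterated_partial s f) p.

Definition diffeomorphism (U U' : set pt) (G : pt -> pt) : Prop :=
  [/\ smooth_on U G, {homo G : p / U p >-> U' p} &
   exists F : pt -> pt,
     [/\ smooth_on U' F, {homo F : p / U' p >-> U p},
         (forall p, U p -> F (G p) = p) &
         (forall p, U' p -> G (F p) = p)]].

Definition lie_bracket (V W : pt -> pt) (p : pt) : pt :=
  'D_(V p) W p - 'D_(W p) V p.

Definition nijenhuis (J : pt -> pt -> pt) (V W : pt -> pt) (p : pt) : pt :=
  let JV q := J q (V q) in
  let JW q := J q (W q) in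
  lie_bracket JV JW p - J p (lie_bracket JV W p)
  - J p (lie_bracket V JW p) - lie_bracket V W p.

(* The exterior derivatives are the invariant formulas evaluated on vector
   fields with constant coefficients, whose brackets vanish.  Normalization:
   (dx /\ dy)(d/dx, d/dy) = 1. *)
Definition dform1 (a : pt -> pt -> R) (p u v : pt) : R :=
  'D_u (fun q => a q v) p - 'D_v (fun q => a q u) p.

Definition dform2 (b : pt -> pt -> pt -> R) (p u v w : pt) : R :=
  'D_u (fun q => b q v w) p - 'D_v (fun q => b q u w) p
  + 'D_w (fun q => b q u v) p.

Definition wedge (a b : pt -> pt -> R) (p u v : pt) : R :=
  a p u * b p v - a p v * b p u.

End Calculus.

(** * Kähler manifolds and PCR-Kähler equivalence *)

Record hermitian_data (R : realType) (n : nat) := HermitianData {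
  carrier : set 'rV[R]_n;
  cplx : 'rV[R]_n -> 'rV[R]_n -> 'rV[R]_n;
  metric : 'rV[R]_n -> 'rV[R]_n -> 'rV[R]_n -> R;
  fundamental_form : 'rV[R]_n -> 'rV[R]_n -> 'rV[R]_n -> R }.

Section Kahler.
Context {R : realType} {n : nat}.
Local Notation pt := 'rV[R]_n.
Local Notation Cvec := 'rV[R[i]]_n.
Implicit Types (N : hermitian_data R n) (H : pt -> set Cvec).

Definition is_complex_structure (U : set pt) (J : pt -> pt -> pt) : Prop :=
  [/\ forall p, U p -> linear (J p),
      forall v, smooth_on U (fun p => J p v),
      forall p v, U p -> J p (J p v) = - v &
      forall V W : pt -> pt, smooth_on U V -> smooth_on U W ->
        forall p, U p -> nijenhuis J V W p = 0].

Definition is_riemannian_metric (U : set pt) (g : pt -> pt -> pt -> R) : Prop :=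
  [/\ forall p v, U p -> scalar (fun u => g p u v),
      forall p u v, U p -> g p u v = g p v u,
      forall p u, U p -> u != 0 -> 0 < g p u u &
      forall u v, smooth_on U (fun p => g p u v : R)].

Definition is_kahler N : Prop :=
  let U := carrier N in
  [/\ open U,
      is_complex_structure U (cplx N),
      is_riemannian_metric U (metric N) &
  [/\ forall p u v, U p -> metric N p (cplx N p u) (cplx N p v) = metric N p u v,
      forall p u v, U p -> fundamental_form N p u v = metric N p (cplx N p u) v &
      forall p u v w, U p -> dform2 (fundamental_form N) p u v w = 0]].

(* Complexified tangent vectors are vectors with entries in [R[i]]. *)
Definition re_vec (w : Cvec) : pt := map_mx (@complex.Re R) w.
Definition im_vec (w : Cvec) : pt := map_mx (@complex.Im R) w.
Definition cvec (v : pt) : Cvec := map_mx (real_complex R) v.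

Definition complexify (L : pt -> pt) (w : Cvec) : Cvec :=
  cvec (L (re_vec w)) + 'i%C *: cvec (L (im_vec w)).

Definition T10 N (p : pt) : set Cvec :=
  [set w | complexify (cplx N p) w = 'i%C *: w].

(* A smooth complex subbundle of the (1,0)-tangent bundle: near every point it
   is spanned by the rows of a smooth frame of constant rank. *)
Definition is_subbundle_T10 N H : Prop :=
  (forall p, carrier N p -> H p `<=` T10 N p) /\
  exists k : nat, forall p, carrier N p ->
    exists (V : set pt) (Z : pt -> 'M[R[i]]_(k, n)),
      [/\ open_nbhs p V, V `<=` carrier N,
          (forall i, smooth_on V (fun q => re_vec (row i (Z q)))),
          (forall i, smooth_on V (fun q => im_vec (row i (Z q)))) &
          forall q, V q ->
            row_free (Z q) /\ H q = [set w | (w <= Z q)%MS]].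

Definition real_subbundle H (p : pt) : set pt := re_vec @` H p.

Definition PCR_kahler_equivalent N H N' H' : Prop :=
  [/\ is_kahler N, is_kahler N', is_subbundle_T10 N H, is_subbundle_T10 N' H' &
   exists G : pt -> pt,
     [/\ diffeomorphism (carrier N) (carrier N') G,
         (forall p, carrier N p -> complexify ('d G p) @` H p = H' (G p)) &
         (forall p u v, carrier N p ->
            real_subbundle H p u -> real_subbundle H p v ->
            metric N' (G p) ('d G p u) ('d G p v) = metric N p u v)]].

End Kahler.

(** * The two structures on the product of the Heisenberg group and R_{>0} *)

Section Heisenberg.
Context {R : realType}.

(* A point is the row vector (x, y, t, r); the first three entries are the
   coordinates (z = x + iy, t) of the Heisenberg group. *)
Local Notation pt := 'rV[R]_4.

Definition cx (p : pt) : R := p 0 0.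
Definition cy (p : pt) : R := p 0 1.
Definition cr (p : pt) : R := p 0 3.

Definition heis_half : set pt := [set p | 0 < cr p].

Definition Dx : pt := delta_mx 0 0.
Definition Dy : pt := delta_mx 0 1.
Definition Dt : pt := delta_mx 0 2.
Definition Dr : pt := delta_mx 0 3.

Definition dx (p v : pt) : R := v 0 0.
Definition dy (p v : pt) : R := v 0 1.
Definition dt (p v : pt) : R := v 0 2.
Definition dr (p v : pt) : R := v 0 3.

Definition X (p : pt) : pt := Dx + (2 * cy p) *: Dt.
Definition Y (p : pt) : pt := Dy - (2 * cx p) *: Dt.
Definition T (p : pt) : pt := Dt.
Definition Tt (p : pt) : pt := 2 *: T p.

Definition omega (p v : pt) : R :=
  dt p v + 2 * cx p * dy p v - 2 * cy p * dx p v.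
Definition omegat (p v : pt) : R := 2^-1 * omega p v.

(* (dx, dy, omega, dr) is the coframe dual to (X, Y, T, d/dr), hence
   (dx, dy, omegat, dr/r) is dual to (X, Y, Tt, r d/dr).  The endomorphisms are
   the linear extensions of their values on these frames. *)
Definition JJ (p v : pt) : pt :=
  dx p v *: Y p - dy p v *: X p - omegat p v *: (cr p *: Dr)
  + (dr p v / cr p) *: Tt p.

Definition II (p v : pt) : pt :=
  dx p v *: Y p - dy p v *: X p + omega p v *: Dr - dr p v *: T p.

Lemma JJ_frame (p : pt) : heis_half p ->
  [/\ JJ p (X p) = Y p, JJ p (Y p) = - X p,
      JJ p (cr p *: Dr) = Tt p & JJ p (Tt p) = - (cr p *: Dr)].
Proof.
rewrite /heis_half /= => r0; have rn0 : cr p != 0 by rewrite gt_eqF.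
rewrite /JJ /omegat /omega /dx /dy /dt /dr /X /Y /Tt /T /Dx /Dy /Dt /Dr.
by split; apply/rowP => -[[|[|[|[|//]]]] ?]; rewrite !mxE /=; field.
Qed.

Lemma II_frame (p : pt) :
  [/\ II p (X p) = Y p, II p (Y p) = - X p,
      II p (T p) = Dr & II p Dr = - T p].
Proof.
rewrite /II /omega /dx /dy /dt /dr /X /Y /T /Dx /Dy /Dt /Dr.
by split; apply/rowP => -[[|[|[|[|//]]]] ?]; rewrite !mxE /=; ring.
Qed.

Definition heis_metric (p u v : pt) : R :=
  dx p u * dx p v + dy p u * dy p v + 4^-1 * (omega p u * omega p v).

Definition cone_metric (p u v : pt) : R :=
  dr p u * dr p v + cr p ^+ 2 * heis_metric p u v.

Definition cone_form : pt -> pt -> pt -> R :=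
  dform1 (fun q v => cr q ^+ 2 / 2 * omegat q v).

Definition riemannian_cone : hermitian_data R 4 :=
  HermitianData heis_half JJ cone_metric cone_form.

Definition metric' (p u v : pt) : R :=
  4 / cr p * (dx p u * dx p v + dy p u * dy p v)
  + 1 / cr p ^+ 2 * (omega p u * omega p v + dr p u * dr p v).

Definition form' (p u v : pt) : R :=
  4 / cr p * wedge dx dy p u v + 1 / cr p ^+ 2 * wedge omega dr p u v.

Definition second_structure : hermitian_data R 4 :=
  HermitianData heis_half II metric' form'.

Definition Z (p : pt) : 'rV[R[i]]_4 :=
  2^-1 *: (cvec (X p) - 'i%C *: cvec (Y p)).

Definition HH (p : pt) : set 'rV[R[i]]_4 := [set c *: Z p | c in setT].

(* The underlying real subbundle of [HH] is the real span of X and Y. *)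
Lemma real_subbundle_HH (p : pt) :
  real_subbundle HH p = [set a *: X p + b *: Y p | a in setT & b in setT].
Proof.
have Zre (a b : R) :
    re_vec (Complex a b *: Z p) = (a / 2) *: X p + (b / 2) *: Y p.
  apply/rowP => j.
  rewrite /re_vec /Z /cvec !mxE.
  move: (X p 0 j) (Y p 0 j) => s t.
  have -> : (2^-1 : R[i]) = Complex (2^-1) 0.
    by rewrite -[2]/((2%:R : R[i])) -(rmorph_nat (real_complex R)) -fmorphV.
  by rewrite /=; ring.
apply/seteqP; split => [u [_ [[a b] _ <-] <-]|u [a _ [b _ <-]]].
  by rewrite Zre; exists (a / 2) => //; exists (b / 2).
exists (Complex (2 * a) (2 * b) *: Z p); first by exists (Complex (2 * a) (2 * b)).
by rewrite Zre; congr (_ *: _ + _ *: _); field.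
Qed.

End Heisenberg.

(* Main.v *)
Require Import Defs.
From HB Require Import structures.
From mathcomp Require Import all_boot all_order all_algebra.
From mathcomp Require Import all_classical all_reals all_analysis.
From mathcomp Require Import complex ring.

(** The equivalence is the map [G(x, y, t, r) = (x, y, t, 4 / r^2)], which only
    reparametrizes the radial coordinate.  The fields [X] and [Y] involve
    neither [r] nor [d/dr], so the differential of [G] sends [X] to [X] and [Y]
    to [Y], hence [Z] to [Z].  On the span of [X] and [Y] the cone metric is
    [r^2 (dx^2 + dy^2)] and the second metric is [4 / r (dx^2 + dy^2)], so
    isometry on this span forces the new radius [r'] to satisfy
    [4 / r' = r^2].  The inverse map takes the radius [r] to [2 / sqrt r].

    It remains to see that both structures are Kähler and that [Z] spans a
    smooth subbundle.  All functions that occur are built from the coordinates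
    by ring operations, inverses and square roots.  Such functions form a class
    closed under partial derivatives ([elementary_partial]), hence all of them
    are smooth ([smooth_on_closed_class]), with derivatives in closed form.

    For integrability, the value of the Nijenhuis tensor of [V] and [W] at a
    point depends on the values of [V] and [W] only: the terms with derivatives
    of [V] and [W] cancel because [J^2 = -1] ([nijenhuis_tensorial]).  What is
    left is a rational identity in the point and two tangent vectors.  The
    compatibility of metric, complex structure and form, and the closedness of
    the two forms, are rational identities as well once the forms are written
    in the coframe.  For the cone this uses
    [d(r^2/4 omega) = r^2 dx /\ dy + r/2 dr /\ omega], which follows from
    [d omega = 4 dx /\ dy]. *)

Set Implicit Arguments.
Unset Strict Implicit.
Unset Printing Implicit Defensive.

Import Order.TTheory GRing.Theory Num.Theory.
Import numFieldNormedType.Exports.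

Local Open Scope classical_set_scope.
Local Open Scope ring_scope.

(** * Smoothness of elementary functions *)

Section SmoothFunctions.
Context {R : realType}.

Lemma near_eq_differentiable (V W : normedModType R) (f g : V -> W) (x : V) :
  (\near x, f x = g x) -> differentiable f x -> differentiable g x.
Proof.
move=> fg /diff_locallyP[df_cont df_approx].
have dg_approx : g \o shift x = cst (g x) + 'd f x +o_ 0 id.
  apply/eqaddoP => _/posnumP[e].
  have /eqaddoP/(_ _ (gt0 e)) := df_approx.
  have : \forall h \near 0, f (h + x) = g (h + x).
    by move: fg; rewrite (near_shift 0) subr0.
  apply: filterS2 => h fgh.
  by rewrite !fctE /= fgh (nbhs_singleton fg).
have dgE : 'd g x = 'd f x :> (V -> W) by exact: diff_unique.
by apply/diff_locallyP; rewrite dgE.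
Qed.

Context {n : nat}.
Local Notation pt := 'rV[R]_n.
Implicit Types (U : set pt).

(** Smoothness by coinduction.  The partial derivatives need to agree with
    members of the class on [U] only, since derivatives at a point of an open
    set depend on the values over this set. *)
Lemma smooth_on_closed_class (W : normedModType R) U (C : set (pt -> W)) :
  open U ->
  (forall f p, C f -> U p -> differentiable f p) ->
  (forall f i, C f ->
     exists2 g, C g & forall p, U p -> 'D_(delta_mx 0 i) f p = g p) ->
  forall f, C f -> smooth_on U f.
Proof.
move=> oU Cdiff Cpartial f Cf s.
have [g Cg fg] : exists2 g, C g & forall p, U p -> iterated_partial s f p = g p.
  elim: s => [|i s [g Cg fg]]; first by exists f.
  have [h Ch gh] := Cpartial _ i Cg; exists h => // p Up.
  rewrite -gh //=; apply: near_eq_derive.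
  by apply: filterS fg _; exact: open_nbhs_nbhs.
move=> p Up; apply: near_eq_differentiable (Cdiff _ _ Cg Up).
apply: filterS (open_nbhs_nbhs (conj oU Up)) => q /fg ->//.
Qed.

(** The derivative is an index of the predicate, so that applying the
    constructors to a given function computes its derivative by unification. *)
Inductive elementary U : (pt -> R) -> (pt -> pt -> R) -> Prop :=
| ElemCst (c : R) : elementary U (fun=> c) (fun _ _ => 0)
| ElemCoord i : elementary U (fun p => p 0 i) (fun _ u => u 0 i)
| ElemOpp f df : elementary U f df ->
    elementary U (fun p => - f p) (fun p u => - df p u)
| ElemAdd f df g dg : elementary U f df -> elementary U g dg ->
    elementary U (fun p => f p + g p) (fun p u => df p u + dg p u)
| ElemMul f df g dg : elementary U f df -> elementary U g dg ->
    elementary U (fun p => f p * g p) (fun p u => f p * dg p u + g p * df p u)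
| ElemInv f df : elementary U f df -> (forall p, U p -> f p != 0) ->
    elementary U (fun p => (f p)^-1)
                 (fun p u => - ((f p)^-1 * (f p)^-1) * df p u)
| ElemSqrt f df : elementary U f df -> (forall p, U p -> 0 < f p) ->
    elementary U (fun p => Num.sqrt (f p))
                 (fun p u => (2 * Num.sqrt (f p))^-1 * df p u).

Lemma ElemSqr U f df : elementary U f df ->
  elementary U (fun p => f p ^+ 2) (fun p u => f p * df p u + f p * df p u).
Proof. by move=> ef; exact: ElemMul. Qed.

Lemma elementary_is_diff U f df p :
  elementary U f df -> U p -> is_diff p f (df p).
Proof.
move=> + Up; elim => {f df} => [c|i|f df _ IH|f df g dg _ IHf _ IHg
  |f df g dg _ IHf _ IHg|f df _ IH fn0|f df _ IH fgt0].
- exact: is_diff_cst.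
- have coord_lin : linear (fun q : pt => q 0 i : R^o).
    by move=> a u v; rewrite !mxE.
  pose coordM := GRing.isLinear.Build _ _ _ _ _ coord_lin.
  pose coordL : {linear pt -> R^o} := HB.pack (fun q : pt => q 0 i) coordM.
  apply: DiffDef; first exact: differentiable_coord.
  by rewrite (@diff_lin _ _ _ coordL) //; exact: coord_continuous.
- exact: is_diffN.
- exact: is_diffD.
- exact: is_diffM.
- have [df_f dfE] := IH; apply: DiffDef.
    exact: differentiableV (fn0 _ Up).
  rewrite diffV ?fn0 // dfE; apply/funext => u /=.
  by rewrite -invfM -expr2.
- have [df_f dfE] := IH.
  have dsqrt : is_diff (f p) Num.sqrt ( *%R^~ (2 * Num.sqrt (f p))^-1).
    have [/derivable1_diffP ds dsE] := is_derive1_sqrt (fgt0 p Up).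
    apply: DiffDef => //; apply/funext => h.
    rewrite -[h in LHS]mulr1 -[_ * 1]/(h *: (1 : R)) linearZ /=.
    by rewrite -deriveE // dsE.
  have comp_diff := is_diff_comp IH dsqrt.
  apply: is_diff_eq comp_diff _.
  by apply/funext => u /=; rewrite mulrC.
Qed.

Lemma elementary_derive U f df p u :
  elementary U f df -> U p -> 'D_u f p = df p u.
Proof.
by move=> f_elem Up; have [dfp <-] := elementary_is_diff f_elem Up; exact: deriveE.
Qed.

(** Each rule of differentiation leads back into the class: the derivatives of
    [f^-1] and [sqrt f] are again expressed through inverses and [sqrt f]. *)
Lemma elementary_partial U f df u :
  elementary U f df -> exists ddf, elementary U (df^~ u) ddf.
Proof.
elim => {f df} => [c|i|f df _ [ddf IH]|f df g dg _ [ddf IHf] _ [ddg IHg]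
  |f df g dg Ef [ddf IHf] Eg [ddg IHg]|f df Ef [ddf IH] fn0|f df Ef [ddf IH] fgt0].
- by eexists; exact: ElemCst.
- by eexists; exact: ElemCst.
- by eexists; apply: ElemOpp IH.
- by eexists; apply: ElemAdd IHf IHg.
- by eexists; apply: ElemAdd; apply: ElemMul; eassumption.
- eexists; apply: ElemMul IH; apply: ElemOpp.
  by apply: ElemMul; apply: ElemInv Ef fn0.
- eexists; apply: ElemMul IH; apply: ElemInv.
    by apply: ElemMul; [exact: ElemCst|exact: ElemSqrt Ef fgt0].
  by move=> p Up; rewrite mulf_neq0 // gt_eqF // sqrtr_gt0 fgt0.
Qed.

Lemma elementary_smooth U f df : open U -> elementary U f df -> smooth_on U f.
Proof.
move=> oU f_elem.
apply: (@smooth_on_closed_class _ U [set g | exists dg, elementary U g dg]) => //.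
- by move=> g p [dg g_elem] Up; case: (elementary_is_diff g_elem Up).
- move=> g i [dg g_elem]; exists (dg^~ (delta_mx 0 i)).
    exact: elementary_partial g_elem.
  by move=> p Up; exact: elementary_derive g_elem Up.
- by exists df.
Qed.

Lemma differentiable_row m (f : pt -> 'rV[R]_m) p :
  (forall k, differentiable (fun q => f q 0 k) p) -> differentiable f p.
Proof.
move=> df.
have -> : f = \sum_(k < m) (fun q => f q 0 k *: delta_mx 0 k).
  by apply/funext => q; rewrite fct_sumE [LHS]row_sum_delta.
by apply: differentiable_sum => k; exact: differentiableZl.
Qed.

Lemma is_derive_row m (f : pt -> 'rV[R]_m) p u df :
  is_derive p u f df <-> forall k, is_derive p u (fun q => f q 0 k) (df 0 k).
Proof.
split=> [[fD <-] k|fD].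
  apply: DeriveDef; first by move/derivable_mxP : fD; exact.
  by rewrite derive_mx ?mxE.
have f_derivable : derivable f p u.
  by apply/derivable_mxP => i k; rewrite (ord1 i); case: (fD k).
apply: DeriveDef => //; apply/rowP => k.
by rewrite derive_mx // mxE; case: (fD k).
Qed.

Definition elementary_row m U (f : pt -> 'rV[R]_m)
    (df : pt -> pt -> 'rV[R]_m) :=
  forall k, elementary U (fun q => f q 0 k) (fun q u => df q u 0 k).

Lemma elementary_row_differentiable m U (f : pt -> 'rV[R]_m) df p :
  elementary_row U f df -> U p -> differentiable f p.
Proof.
move=> f_elem Up; apply: differentiable_row => k.
by case: (elementary_is_diff (f_elem k) Up).
Qed.

Lemma elementary_row_derive m U (f : pt -> 'rV[R]_m) df p u :
  elementary_row U f df -> U p -> 'D_u f p = df p u.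
Proof.
move=> f_elem Up; apply: derive_val; apply/is_derive_row => k.
have [df_p _] := elementary_is_diff (f_elem k) Up.
by apply: DeriveDef; [exact: diff_derivable|exact: elementary_derive (f_elem k) Up].
Qed.

Lemma elementary_row_smooth m U (f : pt -> 'rV[R]_m) df :
  open U -> elementary_row U f df -> smooth_on U f.
Proof.
move=> oU f_elem.
apply: (@smooth_on_closed_class _ U [set g | exists dg, elementary_row U g dg]) => //.
- by move=> g p [dg g_elem] Up; exact: elementary_row_differentiable g_elem Up.
- move=> g i [dg g_elem]; exists (dg^~ (delta_mx 0 i)); last first.
    by move=> p Up; exact: elementary_row_derive.
  have /choice[ddg ddgP] k := elementary_partial (delta_mx 0 i) (g_elem k).
  exists (fun q u => \row_k ddg k q u) => k.
  have -> : (fun q u => (\row_j ddg j q u) 0 k) = ddg k.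
    by apply/funext => q; apply/funext => u; rewrite mxE.
  exact: ddgP.
- by exists df.
Qed.

End SmoothFunctions.

(** * Integrability and complexification *)

Lemma linear_combination (K : nzRingType) (V W : lmodType K) (L : V -> W) :
  linear L -> forall a b u v, L (a *: u + b *: v) = a *: L u + b *: L v.
Proof.
move=> L_lin a b u v; pose LM := GRing.isLinear.Build _ _ _ _ _ L_lin.
pose LL : {linear V -> W} := HB.pack L LM.
by rewrite -[L]/(LL : V -> W) linearD !linearZ.
Qed.

Section ComplexStructures.
Context {R : realType} {n : nat}.
Local Notation pt := 'rV[R]_n.
Implicit Types (U : set pt) (J : pt -> pt -> pt).

Lemma linear_row_expand (L : pt -> pt) v :
  linear L -> L v = \sum_j v 0 j *: L (delta_mx 0 j).
Proof.
move=> L_lin; pose LM := GRing.isLinear.Build _ _ _ _ _ L_lin.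
pose LL : {linear pt -> pt} := HB.pack L LM.
rewrite -[L]/(LL : pt -> pt) {1}(row_sum_delta v) linear_sum.
by apply: eq_bigr => j _; rewrite linearZ.
Qed.

Lemma derive_linear_field U J V p u :
  open U -> (forall q, U q -> linear (J q)) ->
  (forall v, differentiable (J^~ v) p) -> differentiable V p -> U p ->
  'D_u (fun q => J q (V q)) p =
  \sum_j (V p 0 j *: ('D_u (J^~ (delta_mx 0 j)) p : pt) +
          ('D_u V p : pt) 0 j *: J p (delta_mx 0 j)) :> pt.
Proof.
move=> oU J_lin J_diff V_diff Up; apply: derive_val.
have [V_derive J_derive] :
    is_derive p u V ('D_u V p) /\
    forall v, is_derive p u (J^~ v) ('D_u (J^~ v) p).
  by split=> [|v]; apply: derivableP; exact: diff_derivable.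
apply/is_derive_row => k.
pose summand j := (fun q => V q 0 j) * (fun q => J q (delta_mx 0 j) 0 k).
apply: (@near_eq_is_derive _ _ _ (\sum_j summand j)).
  apply: filterS (open_nbhs_nbhs (conj oU Up)) => q Uq.
  rewrite (linear_row_expand (V q) (J_lin q Uq)) summxE fct_sumE.
  by apply: eq_bigr => j _; rewrite mxE.
rewrite summxE.
apply: is_derive_sum => j; apply: is_derive_eq.
  apply: is_deriveM.
    exact: (is_derive_row _ _ _ _).1.
  exact: (is_derive_row _ _ _ _).1.
by rewrite !mxE; congr (_ + _); rewrite [RHS]mulrC.
Qed.

(** The Leibniz rule for the pairing of an endomorphism field with a vector
    field, obtained by comparing the expansion in coordinates for [V] with the
    one for the constant field of value [V p]. *)
Lemma derive_endomorphism_field U J V p u :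
  open U -> (forall q, U q -> linear (J q)) ->
  (forall v, differentiable (J^~ v) p) -> differentiable V p -> U p ->
  'D_u (fun q => J q (V q)) p = 'D_u (J^~ (V p)) p + J p ('D_u V p).
Proof.
move=> oU J_lin J_diff V_diff Up.
have cst_diff : differentiable (cst (V p) : pt -> pt) p by exact: differentiable_cst.
have cstE : 'D_u (J^~ (V p)) p = _ :=
  derive_linear_field u oU J_lin J_diff cst_diff Up.
rewrite (derive_linear_field u oU J_lin J_diff V_diff Up) cstE derive_cst.
rewrite (linear_row_expand ('D_u V p) (J_lin p Up)) -big_split /=.
by apply: eq_bigr => j _; rewrite mxE scale0r addr0.
Qed.

(** Only derivatives of [J] survive: by the Leibniz rule every derivative of [V]
    or [W] occurs twice, with opposite signs once [J^2] is replaced by [-1]. *)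
Lemma nijenhuis_tensorial U J V W p (v := V p) (w := W p) :
  open U -> (forall q, U q -> linear (J q)) ->
  (forall a, differentiable (J^~ a) p) -> (forall a, J p (J p a) = - a) ->
  differentiable V p -> differentiable W p -> U p ->
  nijenhuis J V W p =
  'D_(J p v) (J^~ w) p - 'D_(J p w) (J^~ v) p
  + J p ('D_w (J^~ v) p) - J p ('D_v (J^~ w) p).
Proof.
move=> oU J_lin J_diff JJN V_diff W_diff Up.
have JD a b : J p (a + b) = J p a + J p b.
  by have := J_lin p Up 1 a b; rewrite !scale1r.
have JN a : J p (- a) = - J p a by rewrite -JJN JJN.
rewrite /nijenhuis /lie_bracket -/v -/w.
have JV_derive u : 'D_u (fun q => J q (V q)) p = _ :=
  derive_endomorphism_field u oU J_lin J_diff V_diff Up.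
have JW_derive u : 'D_u (fun q => J q (W q)) p = _ :=
  derive_endomorphism_field u oU J_lin J_diff W_diff Up.
rewrite !JV_derive !JW_derive -/v -/w.
move: ('D_(J p v) (J^~ w) p) ('D_(J p w) (J^~ v) p) ('D_w (J^~ v) p)
  ('D_v (J^~ w) p) ('D_(J p v) W p) ('D_(J p w) V p) ('D_w V p) ('D_v W p).
move=> a b c d e f g h.
rewrite !(JD, JN, JJN).
by apply/rowP => k; rewrite !mxE; ring.
Qed.

Lemma complex_structureP U J :
  open U -> (forall p, U p -> linear (J p)) ->
  (forall v, exists DJ, elementary_row U (J^~ v) DJ) ->
  (forall p v, U p -> J p (J p v) = - v) ->
  (forall p v w, U p ->
     'D_(J p v) (J^~ w) p - 'D_(J p w) (J^~ v) p
     + J p ('D_w (J^~ v) p) - J p ('D_v (J^~ w) p) = 0) ->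
  is_complex_structure U J.
Proof.
move=> oU J_lin J_elem JJN torsion0; split => //.
  by move=> v; have [DJ vJ] := J_elem v; exact: elementary_row_smooth vJ.
move=> V W V_smooth W_smooth p Up.
rewrite (nijenhuis_tensorial oU) ?torsion0 //.
- by move=> v; have [DJ vJ] := J_elem v; exact: elementary_row_differentiable vJ Up.
- by move=> v; exact: JJN.
- exact: V_smooth [::] p Up.
- exact: W_smooth [::] p Up.
Qed.

Lemma complexifyD (L : pt -> pt) : linear L ->
  {morph complexify L : w z / w + z}.
Proof.
move=> L_lin w z.
have LD a b : L (a + b) = L a + L b by have := L_lin 1 a b; rewrite !scale1r.
have reD : re_vec (w + z) = re_vec w + re_vec z.
  by apply/rowP => j; rewrite !mxE; case: (w 0 j) (z 0 j) => [? ?] [].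
have imD : im_vec (w + z) = im_vec w + im_vec z.
  by apply/rowP => j; rewrite !mxE; case: (w 0 j) (z 0 j) => [? ?] [].
rewrite /complexify reD imD !LD; apply/rowP => j; rewrite !mxE.
by rewrite !rmorphD /=; ring.
Qed.

Lemma complexifyZ (L : pt -> pt) c w : linear L ->
  complexify L (c *: w) = c *: complexify L w.
Proof.
move=> L_lin.
have reZ : re_vec (c *: w) = complex.Re c *: re_vec w + (- complex.Im c) *: im_vec w.
  by apply/rowP => j; rewrite !mxE; case: (w 0 j) (c) => [? ?] [? ?] /=; ring.
have imZ : im_vec (c *: w) = complex.Re c *: im_vec w + complex.Im c *: re_vec w.
  by apply/rowP => j; rewrite !mxE; case: (w 0 j) (c) => [? ?] [? ?] /=; ring.
rewrite /complexify reZ imZ !(linear_combination L_lin).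
apply/rowP => j; rewrite !mxE.
move: (L (re_vec w) 0 j) (L (im_vec w) 0 j) => s t.
by case: c {reZ imZ} => a b; apply/eqP; rewrite eq_complex /=; apply/andP; split;
  apply/eqP; ring.
Qed.

Lemma complexify_cvec (L : pt -> pt) v : linear L ->
  complexify L (cvec v) = cvec (L v).
Proof.
move=> L_lin.
have L0 : L 0 = 0.
  by have := linear_combination L_lin 0 0 0 0; rewrite !scale0r addr0.
have reE : re_vec (cvec v) = v by apply/rowP => j; rewrite !mxE.
have imE : im_vec (cvec v) = 0 by apply/rowP => j; rewrite !mxE.
rewrite /complexify reE imE L0; apply/rowP => j; rewrite !mxE rmorph0.
by rewrite mulr0 addr0.
Qed.

Lemma cvecN (v : pt) : cvec (- v) = - cvec v.
Proof. by apply/rowP => j; rewrite !mxE rmorphN. Qed.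

End ComplexStructures.

(** * The two Kähler structures *)

Section HeisenbergStructures.
Context {R : realType}.
Local Notation pt := 'rV[R]_4.
Local Notation U := (@heis_half R).

Definition row4 (a b c d : R) : pt := \row_(k < 4) [:: a; b; c; d]`_k.

Lemma row4E a b c d :
  (row4 a b c d 0 0 = a) * (row4 a b c d 0 1 = b) *
  (row4 a b c d 0 2 = c) * (row4 a b c d 0 3 = d).
Proof. by rewrite !mxE. Qed.

Lemma row4_eq (u v : pt) : u 0 0 = v 0 0 -> u 0 1 = v 0 1 ->
  u 0 2 = v 0 2 -> u 0 3 = v 0 3 -> u = v.
Proof.
move=> e0 e1 e2 e3; apply/rowP => -[[|[|[|[|//]]]] lt4].
- by have -> : Ordinal lt4 = 0 by exact/val_inj.
- by have -> : Ordinal lt4 = 1 by exact/val_inj.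
- by have -> : Ordinal lt4 = 2 by exact/val_inj.
- by have -> : Ordinal lt4 = 3 by exact/val_inj.
Qed.

Lemma elementary_row4 V (a b c d : pt -> R) da db dc dd :
  elementary V a da -> elementary V b db -> elementary V c dc ->
  elementary V d dd ->
  elementary_row V (fun q => row4 (a q) (b q) (c q) (d q))
    (fun q u => row4 (da q u) (db q u) (dc q u) (dd q u)).
Proof.
move=> ea eb ec ed k.
have fE (a' b' c' d' : pt -> R) :
    (fun q => row4 (a' q) (b' q) (c' q) (d' q) 0 k)
    = (fun q => [:: a' q; b' q; c' q; d' q]`_k).
  by apply/funext => q; rewrite mxE.
have dfE (a' b' c' d' : pt -> pt -> R) :
    (fun q u => row4 (a' q u) (b' q u) (c' q u) (d' q u) 0 k)
    = (fun q u => [:: a' q u; b' q u; c' q u; d' q u]`_k).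
  by apply/funext => q; apply/funext => u; rewrite mxE.
by rewrite fE dfE; case: k {fE dfE} => -[|[|[|[|//]]]] lt4.
Qed.

Lemma cr_neq0 (p : pt) : U p -> cr p != 0.
Proof. by rewrite /heis_half /= => ?; rewrite gt_eqF. Qed.

Lemma open_heis_half : open U.
Proof.
have -> : U = (fun p : pt => p 0 3) @^-1` [set r | 0 < r] by [].
apply: open_comp; last exact: open_gt.
by move=> p _; exact: coord_continuous.
Qed.

Ltac elementary_tac :=
  repeat first [exact: ElemCst | exact: ElemCoord | apply: ElemSqr
    | apply: ElemMul | apply: ElemAdd | apply: ElemOpp
    | apply: ElemInv; last (by move=> ? /cr_neq0 ?; rewrite ?expf_neq0)].

Lemma JJE (p v : pt) : JJ p v = row4 (- dy p v) (dx p v)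
  (- 2 * (cx p * dx p v + cy p * dy p v) + 2 * (cr p)^-1 * dr p v)
  (- (omegat p v * cr p)).
Proof. by apply: row4_eq; rewrite row4E !mxE /=; rewrite /dx /dy; ring. Qed.

Lemma IIE (p v : pt) : II p v = row4 (- dy p v) (dx p v)
  (- 2 * (cx p * dx p v + cy p * dy p v) - dr p v) (omega p v).
Proof.
by apply: row4_eq; rewrite row4E !mxE /=; rewrite /dx /dy /dr /omega; ring.
Qed.

Lemma JJ_linear (p : pt) : linear (JJ p).
Proof.
move=> a u v; rewrite !JJE; apply: row4_eq; rewrite !(mxE, row4E) /=;
  by rewrite /dx /dy /omegat /omega /dr /dt /dx /dy !mxE /=; ring.
Qed.

Lemma II_linear (p : pt) : linear (II p).
Proof.
move=> a u v; rewrite !IIE; apply: row4_eq; rewrite !(mxE, row4E) /=;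
  by rewrite /dx /dy /omega /dr /dt /dx /dy !mxE /=; ring.
Qed.

Lemma elementary_JJ v : exists DJ, elementary_row U (JJ^~ v) DJ.
Proof.
rewrite (funext (fun q => JJE q v)) /dx /dy /dr /omegat /omega /dt /dx /dy.
by eexists; apply: elementary_row4; elementary_tac.
Qed.

Lemma elementary_II v : exists DI, elementary_row U (II^~ v) DI.
Proof.
rewrite (funext (fun q => IIE q v)) /dx /dy /dr /omega /dt /dx /dy.
by eexists; apply: elementary_row4; elementary_tac.
Qed.

Lemma derive_JJ (p u v : pt) : U p ->
  'D_u (JJ^~ v) p = row4 0 0
    (- 2 * (dx p u * dx p v + dy p u * dy p v + dr p u * dr p v / cr p ^+ 2))
    (- (dr p u * omegat p v + cr p * (dx p u * dy p v - dy p u * dx p v))).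
Proof.
move=> Up; have r0 := cr_neq0 Up; rewrite (funext (fun q => JJE q v)).
rewrite /omegat /omega /dx /dy /dr /dt /cx /cy.
etransitivity.
  by apply: elementary_row_derive Up; apply: elementary_row4; elementary_tac.
by congr row4; rewrite /cr in r0 *; field.
Qed.

Lemma derive_II (p u v : pt) :
  'D_u (II^~ v) p = row4 0 0 (- 2 * (dx p u * dx p v + dy p u * dy p v))
    (2 * (dx p u * dy p v - dy p u * dx p v)).
Proof.
rewrite (funext (fun q => IIE q v)).
rewrite /omega /dx /dy /dr /dt /cx /cy.
etransitivity.
  apply: (@elementary_row_derive _ _ _ setT) => //.
  by apply: elementary_row4; elementary_tac.
by congr row4; ring.
Qed.

Lemma JJ_complex_structure : is_complex_structure U (@JJ R).
Proof.
apply: complex_structureP.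
- exact: open_heis_half.
- by move=> p _; exact: JJ_linear.
- exact: elementary_JJ.
- move=> p v Up; have r0 := cr_neq0 Up.
  rewrite !JJE /omegat /omega /dx /dy /dr /dt !row4E.
  by apply: row4_eq; rewrite row4E mxE //; field.
- move=> p v w Up; have r0 := cr_neq0 Up.
  rewrite !derive_JJ // !JJE /omegat /omega /dx /dy /dr /dt !row4E.
  by apply: row4_eq; rewrite !(mxE, row4E) /=; field.
Qed.

Lemma II_complex_structure : is_complex_structure U (@II R).
Proof.
apply: complex_structureP.
- exact: open_heis_half.
- by move=> p _; exact: II_linear.
- exact: elementary_II.
- move=> p v Up.
  rewrite !IIE /omega /dx /dy /dr /dt !row4E.
  by apply: row4_eq; rewrite row4E mxE //; ring.
- move=> p v w Up.
  rewrite !derive_II // !IIE /omega /dx /dy /dr /dt !row4E.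
  by apply: row4_eq; rewrite !(mxE, row4E) /=; ring.
Qed.

(** Positivity of any metric that is diagonal in the coframe
    [dx, dy, omega, dr], which is the case of both metrics. *)
Lemma coframe_sumsq_gt0 (p u : pt) (a b c d : R) :
  0 < a -> 0 < b -> 0 < c -> 0 < d -> u != 0 ->
  0 < a * dx p u ^+ 2 + b * dy p u ^+ 2 + c * omega p u ^+ 2 + d * dr p u ^+ 2.
Proof.
move=> a0 b0 c0 d0.
have sq0 (e f : R) : 0 < e -> 0 <= e * f ^+ 2.
  by move=> /ltW ?; rewrite mulr_ge0 ?sqr_ge0.
rewrite lt0r !addr_ge0 ?sq0 // andbT; apply: contraNN.
rewrite !paddr_eq0 ?addr_ge0 ?sq0 // !mulf_eq0 !orbb.
rewrite !(gt_eqF a0, gt_eqF b0, gt_eqF c0, gt_eqF d0) /=.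
move=> /andP[/andP[/andP[/eqP ux /eqP uy] /eqP +] /eqP ur].
rewrite /omega ux uy !mulr0 addr0 subr0 => ut.
by apply/eqP; apply: row4_eq; rewrite mxE.
Qed.

Lemma cone_metric_riemannian : is_riemannian_metric U (@cone_metric R).
Proof.
split.
- move=> p v Up a u w.
  rewrite /cone_metric /heis_metric /omega /dx /dy /dr /dt !mxE /=; ring.
- by move=> p u v Up; rewrite /cone_metric /heis_metric; ring.
- move=> p u Up u0; have r2 : 0 < cr p ^+ 2 by rewrite exprn_gt0.
  have -> : cone_metric p u u =
      cr p ^+ 2 * dx p u ^+ 2 + cr p ^+ 2 * dy p u ^+ 2
      + (cr p ^+ 2 / 4) * omega p u ^+ 2 + 1 * dr p u ^+ 2.
    by rewrite /cone_metric /heis_metric; ring.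
  by rewrite coframe_sumsq_gt0 ?divr_gt0.
- move=> u v; pose smooth := elementary_smooth open_heis_half.
  rewrite /cone_metric /heis_metric /omega /dx /dy /dr /dt /cx /cy.
  by apply: smooth; elementary_tac.
Qed.

Lemma metric'_riemannian : is_riemannian_metric U (@metric' R).
Proof.
split.
- move=> p v Up a u w.
  rewrite /metric' /omega /dx /dy /dr /dt !mxE /=; ring.
- by move=> p u v Up; rewrite /metric'; ring.
- move=> p u Up u0; have r2 : 0 < cr p ^+ 2 by rewrite exprn_gt0.
  have -> : metric' p u u =
      (4 / cr p) * dx p u ^+ 2 + (4 / cr p) * dy p u ^+ 2
      + (1 / cr p ^+ 2) * omega p u ^+ 2 + (1 / cr p ^+ 2) * dr p u ^+ 2.
    by rewrite /metric'; ring.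
  by rewrite coframe_sumsq_gt0 ?divr_gt0.
- move=> u v; pose smooth := elementary_smooth open_heis_half.
  rewrite /metric' /omega /dx /dy /dr /dt /cx /cy.
  by apply: smooth; elementary_tac.
Qed.

Lemma cone_formE (p u v : pt) : cone_form p u v =
  cr p ^+ 2 * wedge dx dy p u v + cr p / 2 * wedge dr omega p u v.
Proof.
have D w z : 'D_w (fun q => cr q ^+ 2 / 2 * omegat q z) p =
    cr p * dr p w * omegat p z
    + cr p ^+ 2 / 2 * (dx p w * dy p z - dy p w * dx p z).
  rewrite /omegat /omega /dx /dy /dr /dt /cx /cy.
  etransitivity.
    by apply: (@elementary_derive _ _ setT) => //; elementary_tac.
  by rewrite /cr; field.
by rewrite /cone_form /dform1 !D /wedge /omegat; field.
Qed.

Lemma cone_kahler : is_kahler (riemannian_cone (R := R)).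
Proof.
split => /=.
- exact: open_heis_half.
- exact: JJ_complex_structure.
- exact: cone_metric_riemannian.
- split.
  + move=> p u v Up; have r0 := cr_neq0 Up.
    rewrite !JJE /cone_metric /heis_metric /omegat /omega /dx /dy /dr /dt !row4E.
    by field.
  + move=> p u v Up; have r0 := cr_neq0 Up.
    rewrite cone_formE JJE /cone_metric /heis_metric /wedge.
    by rewrite /omegat /omega /dx /dy /dr /dt !row4E; field.
  + move=> p u v w Up.
    have D a b c : 'D_a (fun q => cone_form q b c) p =
        2 * cr p * dr p a * wedge dx dy p b c + dr p a / 2 * wedge dr omega p b c
        + cr p * (dr p b * (dx p a * dy p c - dy p a * dx p c)
                  - dr p c * (dx p a * dy p b - dy p a * dx p b)).
      rewrite (funext (fun q => cone_formE q b c)).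
      rewrite /wedge /omega /dx /dy /dr /dt /cx /cy.
      etransitivity.
        by apply: (@elementary_derive _ _ setT) => //; elementary_tac.
      by rewrite /cr; field.
    rewrite /dform2 !D /wedge.
    by rewrite /omega /dx /dy /dr /dt; field.
Qed.

Lemma second_kahler : is_kahler (second_structure (R := R)).
Proof.
split => /=.
- exact: open_heis_half.
- exact: II_complex_structure.
- exact: metric'_riemannian.
- split.
  + move=> p u v Up; have r0 := cr_neq0 Up.
    rewrite !IIE /metric' /omega /dx /dy /dr /dt !row4E.
    by field.
  + move=> p u v Up; have r0 := cr_neq0 Up.
    rewrite /form' IIE /metric' /wedge.
    by rewrite /omega /dx /dy /dr /dt !row4E; field.
  + move=> p u v w Up; have r0 := cr_neq0 Up.
    have D a b c : 'D_a (fun q => form' q b c) p =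
        - 4 / cr p ^+ 2 * dr p a * wedge dx dy p b c
        - 2 / cr p ^+ 3 * dr p a * wedge omega dr p b c
        + 2 / cr p ^+ 2 * (dr p c * (dx p a * dy p b - dy p a * dx p b)
                           - dr p b * (dx p a * dy p c - dy p a * dx p c)).
      rewrite /form' /wedge /omega /dx /dy /dr /dt /cx /cy.
      etransitivity.
        by apply: (elementary_derive _ _ Up) => //; elementary_tac.
      by rewrite /cr in r0 *; field.
    rewrite /dform2 !D /wedge.
    by rewrite /omega /dx /dy /dr /dt; field.
Qed.

(** * The subbundle spanned by Z *)

Lemma complexify_Z (L : pt -> pt) p : linear L ->
  complexify L (Z p) = 2^-1 *: (cvec (L (X p)) - 'i%C *: cvec (L (Y p))).
Proof.
move=> L_lin.
by rewrite /Z -scaleNr !(complexifyZ, complexifyD, complexify_cvec) // scaleNr.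
Qed.

Lemma HH_sub_T10 (N : hermitian_data R 4) p : linear (cplx N p) ->
  cplx N p (X p) = Y p -> cplx N p (Y p) = - X p -> HH p `<=` T10 N p.
Proof.
move=> J_lin JX JY _ [c _ <-]; rewrite /T10 /= complexifyZ // complexify_Z //.
rewrite JX JY cvecN /Z !scalerN opprK scalerA [_ * c]mulrC -scalerA.
congr (_ *: _); rewrite scalerA [_ * 2^-1]mulrC -scalerA; congr (_ *: _).
by rewrite scalerBr scalerA -[_ * _]expr2 complex.sqr_i scaleN1r opprK addrC.
Qed.

Lemma half_complex : (2^-1 : R[i]) = Complex (2^-1) 0.
Proof. by rewrite -[2]/((2%:R : R[i])) -(rmorph_nat (real_complex R)) -fmorphV. Qed.

Lemma re_Z (p : pt) : re_vec (Z p) = 2^-1 *: X p.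
Proof.
apply/rowP => j; rewrite /re_vec /Z /cvec !mxE.
by move: (X p 0 j) (Y p 0 j) => s t; rewrite half_complex /=; ring.
Qed.

Lemma im_Z (p : pt) : im_vec (Z p) = - 2^-1 *: Y p.
Proof.
apply/rowP => j; rewrite /im_vec /Z /cvec !mxE.
by move: (X p 0 j) (Y p 0 j) => s t; rewrite half_complex /=; ring.
Qed.

Lemma Z_neq0 (p : pt) : Z p != 0.
Proof.
(* The x-component of the real part of Z is 1/2. *)
apply/eqP => Z0; have /rowP/(_ 0) := re_Z p.
rewrite Z0 !mxE /= => /eqP.
by rewrite mulr0 addr0 mulr1 eq_sym invr_eq0 pnatr_eq0.
Qed.

Lemma HH_subbundle (N : hermitian_data R 4) : carrier N = U ->
  (forall p, linear (cplx N p)) ->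
  (forall p, U p -> cplx N p (X p) = Y p) ->
  (forall p, U p -> cplx N p (Y p) = - X p) ->
  is_subbundle_T10 N HH.
Proof.
move=> NU J_lin JX JY; split.
  by rewrite NU => p Up; apply: HH_sub_T10 => //; [exact: JX|exact: JY].
exists 1; rewrite NU => p Up; exists U, (@Z R); split => //.
- by split => //; exact: open_heis_half.
- move=> i.
  have -> : (fun q => re_vec (row i (Z q)) : pt)
      = (fun q => row4 (2^-1) 0 (cy q) 0).
    apply/funext => q; rewrite row_id re_Z.
    by apply: row4_eq; rewrite row4E !mxE /=; field.
  apply: elementary_row_smooth open_heis_half _.
  by apply: elementary_row4; elementary_tac.
- move=> i.
  have -> : (fun q => im_vec (row i (Z q)) : pt)
      = (fun q => row4 0 (- 2^-1) (cx q) 0).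
    apply/funext => q; rewrite row_id im_Z.
    by apply: row4_eq; rewrite row4E !mxE /=; field.
  apply: elementary_row_smooth open_heis_half _.
  by apply: elementary_row4; elementary_tac.
- move=> q Uq; split; first by rewrite /row_free rank_rV Z_neq0.
  apply/seteqP; split => w /=.
    by case=> c _ <-; exact: scalemx_sub.
  by move=> /sub_rVP[c ->]; exists c.
Qed.

(** * The equivalence *)

Definition pcr_map (p : pt) : pt :=
  row4 (p 0 0) (p 0 1) (p 0 2) (4 * (cr p ^+ 2)^-1).

Definition pcr_inv (p : pt) : pt :=
  row4 (p 0 0) (p 0 1) (p 0 2) (2 * (Num.sqrt (cr p))^-1).

Lemma cr_pcr_map p : cr (pcr_map p) = 4 * (cr p ^+ 2)^-1.
Proof. by rewrite /cr /pcr_map row4E. Qed.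

Lemma elementary_pcr_map : exists D, elementary_row U pcr_map D.
Proof.
by rewrite /pcr_map /cr; eexists; apply: elementary_row4; elementary_tac.
Qed.

Lemma elementary_pcr_inv : exists D, elementary_row U pcr_inv D.
Proof.
rewrite /pcr_inv /cr; eexists; apply: elementary_row4; elementary_tac.
apply: ElemInv; last by move=> q Uq; rewrite gt_eqF // sqrtr_gt0.
by apply: ElemSqrt => //; exact: ElemCoord.
Qed.

Lemma pcr_diffeomorphism : diffeomorphism U U pcr_map.
Proof.
have [Dmap map_elem] := elementary_pcr_map.
have [Dinv inv_elem] := elementary_pcr_inv.
split; first exact: elementary_row_smooth open_heis_half map_elem.
  by move=> p Up; rewrite /heis_half /= cr_pcr_map mulr_gt0 // invr_gt0 exprn_gt0.
exists pcr_inv; split.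
- exact: elementary_row_smooth open_heis_half inv_elem.
- move=> p Up; rewrite /heis_half /cr /= /pcr_inv row4E.
  by rewrite mulr_gt0 // invr_gt0 sqrtr_gt0.
- move=> p Up; have r0 := cr_neq0 Up.
  have sqrtE : Num.sqrt (4 * (cr p ^+ 2)^-1) = 2 * (cr p)^-1.
    have -> : 4 * (cr p ^+ 2)^-1 = (2 * (cr p)^-1) ^+ 2 by field.
    by rewrite sqrtr_sqr gtr0_norm // mulr_gt0 // invr_gt0.
  rewrite /pcr_inv cr_pcr_map sqrtE.
  apply: row4_eq; rewrite !row4E //.
  by rewrite -/(cr p); field.
- move=> p Up; have r0 := cr_neq0 Up.
  have s2 : Num.sqrt (cr p) ^+ 2 = cr p by rewrite sqr_sqrtr // ltW.
  have s0 : Num.sqrt (cr p) != 0 by rewrite gt_eqF // sqrtr_gt0.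
  rewrite /pcr_map [cr _]row4E; apply: row4_eq; rewrite !row4E //.
  by rewrite -[RHS]/(cr p) -[RHS]s2; field.
Qed.

Lemma diff_pcr_map p v : U p ->
  'd pcr_map p v = row4 (v 0 0) (v 0 1) (v 0 2) (- 8 / cr p ^+ 3 * v 0 3).
Proof.
move=> Up; have r0 := cr_neq0 Up; have [D map_elem] := elementary_pcr_map.
rewrite -deriveE; last exact: elementary_row_differentiable map_elem Up.
rewrite {map_elem}/pcr_map /cr.
etransitivity.
  apply: (elementary_row_derive _ _ Up).
  by apply: elementary_row4; elementary_tac.
by congr row4; rewrite /cr in r0 *; field.
Qed.

Lemma diff_pcr_map_X p : U p -> 'd pcr_map p (X p) = X (pcr_map p).
Proof.
move=> Up; rewrite diff_pcr_map //.
by apply: row4_eq; rewrite row4E !mxE /= /cy ?row4E; ring.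
Qed.

Lemma diff_pcr_map_Y p : U p -> 'd pcr_map p (Y p) = Y (pcr_map p).
Proof.
move=> Up; rewrite diff_pcr_map //.
by apply: row4_eq; rewrite row4E !mxE /= /cx ?row4E; ring.
Qed.

Lemma pcr_map_HH p : U p -> complexify ('d pcr_map p) @` HH p = HH (pcr_map p).
Proof.
move=> Up.
have dZ : complexify ('d pcr_map p) (Z p) = Z (pcr_map p).
  by rewrite complexify_Z ?diff_pcr_map_X ?diff_pcr_map_Y //; exact: linearP.
have d_lin : linear ('d pcr_map p) by exact: linearP.
apply/seteqP; split => w.
  by case=> _ [c _ <-] <-; rewrite complexifyZ // dZ; exists c.
case=> c _ <-; exists (c *: Z p); first by exists c.
by rewrite complexifyZ // dZ.
Qed.

Lemma pcr_map_isometry p a b c d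
    (u := a *: X p + b *: Y p) (v := c *: X p + d *: Y p) : U p ->
  metric' (pcr_map p) ('d pcr_map p u) ('d pcr_map p v) = cone_metric p u v.
Proof.
move=> Up; have r0 := cr_neq0 Up.
rewrite !diff_pcr_map // /metric' cr_pcr_map /omega /dx /dy /dr /dt /cx /cy.
rewrite !row4E /cone_metric /heis_metric /omega /dx /dy /dr /dt /cx /cy.
by rewrite /u /v !mxE /= /cx /cy; field.
Qed.

End HeisenbergStructures.

Theorem theorem5p6 (R : realType) :
  PCR_kahler_equivalent (riemannian_cone (R := R)) HH second_structure HH.
Proof.
split.
- exact: cone_kahler.
- exact: second_kahler.
- apply: HH_subbundle => //= p; first exact: JJ_linear.
  + by case/JJ_frame.
  + by case/JJ_frame.
- apply: HH_subbundle => //= p; first exact: II_linear.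
  + by case: (II_frame p).
  + by case: (II_frame p).
exists (@pcr_map R); split.
- exact: pcr_diffeomorphism.
- exact: pcr_map_HH.
- move=> p u v Up; rewrite !real_subbundle_HH => -[a _ [b _ <-]] [c _ [d _ <-]].
  exact: pcr_map_isometry.
Qed.
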